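(* Let $r\ge 2$ and $0\le\alpha<3$ be real numbers. A cubic graph $G=(V,E)$ admits an $(r,\alpha)$-flow if and only if there exists a bisection $(V_1,V_2)$ of $G$ which satisfies the following two conditions: 1. for every subset $A$ of $V$, $d(A)\ge\Delta(A)$; and 2. for every nonempty subset $A$ of $V$, $\alpha\ge\dfrac{2d(A)-(d(A)-\Delta(A))\,r}{2|A|}$. Moreover, Condition 1 is redundant (automatically satisfied) if $(V_1,V_2)$ is known to be orientable.
   Context: Graphs are finite and undirected; parallel edges are allowed, loops are not. A cubic graph is a graph in which every vertex has degree $3$. For real numbers $r\ge 2$ and $\alpha\ge 0$, an $(r,\alpha)$-flow in a directed graph $D=(V,E)$ is an assignment $f:E\to[1,r-1]$ such that for every vertex $x\in V$, $\left|\sum_{e\in E^+(x)}f(e)-\sum_{e\in E^-(x)}f(e)\right|\le\alpha$, where $E^+(x)$, respectively $E^-(x)$, is the set of edges directed from, respectively toward, $x$ in $D$. An undirected graph $G$ admits an $(r,\alpha)$-flow if some orientation of $G$ admits such a flow. A bisection of $G=(V,E)$ is a partition $(V_1,V_2)$ of $V$ into two disjoint subsets with $|V_1|=|V_2|$. For $A\subseteq V$, $d(A)$ is the number of edges with one endvertex in $A$ and the other in $V\setminus A$, and, with respect to the given bisection, $\Delta(A)=\bigl||V_2\cap A|-|V_1\cap A|\bigr|$. A bisection $(V_1,V_2)$ of a cubic graph $G$ is orientable if there exists an orientation of $G$ in which, for $i=1,2$, $V_i$ is exactly the set of vertices of outdegree $i$. *)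

(* Defs.v *)
From HB Require Import structures.
From mathcomp Require Import all_boot all_order all_algebra.
From mathcomp Require Import reals.

Set Implicit Arguments.
Unset Strict Implicit.
Unset Printing Implicit Defensive.

Import Order.TTheory GRing.Theory Num.Theory.
Local Open Scope ring_scope.

(* Distinct edges may have the same set of endvertices (parallel edges);
   [ends_card2] excludes loops. *)
Record multigraph (V E : finType) := Multigraph {
  ends : E -> {set V};
  ends_card2 : forall e, #|ends e| = 2%N
}.

Record digraph (V E : finType) := Digraph {
  tail : E -> V;
  head : E -> V;
  tail_neq_head : forall e, tail e != head e
}.

Section Graphs.
Variables V E : finType.
Implicit Types (G : multigraph V E) (D : digraph V E) (A : {set V}).

Definition degree G (x : V) : nat := #|[set e | x \in ends G e]|.

Definition cubic G : Prop := forall x, degree G x = 3%N.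

Definition out_edges D (x : V) : {set E} := [set e | tail D e == x].

Definition in_edges D (x : V) : {set E} := [set e | head D e == x].

Definition orientation G D : Prop :=
  forall e, ends G e = [set tail D e; head D e].

Definition is_flow (R : realType) (r alpha : R) D (f : E -> R) : Prop :=
  (forall e, 1 <= f e <= r - 1) /\
  (forall x, `|\sum_(e in out_edges D x) f e - \sum_(e in in_edges D x) f e|
             <= alpha).

Definition admits_flow (R : realType) (r alpha : R) G : Prop :=
  exists2 D, orientation G D & exists f : E -> R, is_flow r alpha D f.

(* The parts are ordered and may be empty (only when V itself is empty). *)
Definition bisection (V1 V2 : {set V}) : Prop :=
  [/\ V1 :|: V2 = [set: V], [disjoint V1 & V2] & #|V1| = #|V2|].

Definition boundary G A : {set E} :=
  [set e | [exists x in A, exists y in ~: A, ends G e == [set x; y]]].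

Definition cut_size G A : nat := #|boundary G A|.

Definition imbalance (V1 V2 A : {set V}) : nat :=
  `|(#|V2 :&: A|)%:Z - (#|V1 :&: A|)%:Z|%N.

Definition orientable G (V1 V2 : {set V}) : Prop :=
  exists2 D, orientation G D &
    V1 = [set x | #|out_edges D x| == 1%N] /\
    V2 = [set x | #|out_edges D x| == 2%N].

Definition cut_condition G (V1 V2 : {set V}) : Prop :=
  forall A, (cut_size G A >= imbalance V1 V2 A)%N.

Definition flow_condition (R : realType) (r alpha : R) G (V1 V2 : {set V})
    : Prop :=
  forall A, A != set0 ->
    let d := (cut_size G A)%:R in
    let Delta := (imbalance V1 V2 A)%:R in
    alpha >= (2 * d - (d - Delta) * r) / (2 * #|A|%:R).

End Graphs.

(* Main.v *)
From mathcomp Require Import all_boot all_order all_algebra.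
From mathcomp Require Import reals lra zify.
Require Import Defs.

Set Implicit Arguments.
Unset Strict Implicit.
Unset Printing Implicit Defensive.

Import Order.TTheory GRing.Theory Num.Theory.
Local Open Scope ring_scope.

(** Write out(A) and in(A) for the numbers of edges leaving and entering A in an
    orientation of the cubic graph G; their sum is d(A).

    From a flow to a bisection: since all values are at least 1 and alpha < 3,
    no vertex is a source or a sink, so outdegrees are 1 or 2 and define V_1 and
    V_2.  Summing outdegree minus indegree over A gives
    out(A) - in(A) = |V_2 \cap A| - |V_1 \cap A| ([net_outdegree]), whence
    Delta(A) = |out(A) - in(A)| <= d(A); for A = V both sides vanish, so the
    parts are equinumerous.  Summing the flow excess over A gives
    out(A) - (r - 1) in(A) <= alpha |A| and the same with out and in exchanged.
    The stronger of these two inequalities is Condition 2, rewritten in terms of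
    d(A) and Delta(A) ([flow_cut_bound]).

    From a bisection to a flow: two applications of Hoffman's circulation
    theorem, in the form [bounded_excess_flow], where the excess of each vertex
    is confined to an interval.  Over the integers, with edge values 0 or 1
    deciding which edges of an arbitrary reference orientation to reverse, it
    turns Condition 1 into an orientation with outdegree i on V_i
    ([orientable_of_cut_condition]).  Over the reals, in that orientation and
    with edge values in [1, r - 1] and excess in [-alpha, alpha], its hypothesis
    is Condition 2 by the computation above ([flow_of_bisection]).

    Hoffman's theorem is deduced from the existence of submodular flows
    ([submodular_flow]), in which f(out A) - f(in A) is bounded by a submodular
    function of A.  It is proved by collapsing the capacity interval of one edge
    at a time to a point: the lower limits on that point come from sets that the
    edge enters, the upper limits from sets that it leaves, and uncrossing shows
    that they are compatible.  The point is a maximum of finitely many sums and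
    differences of the data, so the proof works over any totally ordered ring
    and gives real and integral flows alike. *)

(** * Submodular flows *)

Section SubmodularFlow.

Context {R : realDomainType} {T E : finType} (tl hd : E -> T).
Implicit Types (l u f : E -> R) (A B : {set T}) (b : {set T} -> R) (e : E).

Definition leaving A : {set E} := [set e | (tl e \in A) && (hd e \notin A)].
Definition entering A : {set E} := [set e | (hd e \in A) && (tl e \notin A)].

(** The minimum over l <= f <= u of the net outflow of f from A. *)
Definition least_outflow l u A : R :=
  \sum_(e in leaving A) l e - \sum_(e in entering A) u e.

Definition net_outflow f A : R := least_outflow f f A.

Definition submodular b : Prop :=
  forall A B, b (A :&: B) + b (A :|: B) <= b A + b B.

Let contribution l u A e : R :=
  (if e \in leaving A then l e else 0) - (if e \in entering A then u e else 0).

Let least_outflowE l u A : least_outflow l u A = \sum_e contribution l u A e.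
Proof.
by rewrite /least_outflow big_mkcond [X in _ - X]big_mkcond -sumrB.
Qed.

Let least_outflowD1 l u A e0 : least_outflow l u A =
  contribution l u A e0 + \sum_(e | e != e0) contribution l u A e.
Proof. by rewrite least_outflowE (bigD1 e0). Qed.

(** Edges inside A count once at each end, with opposite signs. *)
Lemma net_outflowE f A :
  net_outflow f A =
  \sum_(x in A) (\sum_(e | tl e == x) f e - \sum_(e | hd e == x) f e).
Proof.
have ends_in (g : E -> T) :
    \sum_(x in A) \sum_(e | g e == x) f e = \sum_(e | g e \in A) f e.
  rewrite [RHS](partition_big g (mem A)) //=; apply: eq_bigr => x xA.
  by apply: eq_bigl => e; case: eqP => [->|]; rewrite ?xA ?andbF.
rewrite sumrB !ends_in /net_outflow least_outflowE.
rewrite [X in _ = X - _]big_mkcond [X in _ = _ - X]big_mkcond -sumrB.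
apply: eq_bigr => e _; rewrite /contribution !inE.
by case: (tl e \in A); case: (hd e \in A) => /=; rewrite ?subrr ?subr0.
Qed.

(** Supermodularity of [least_outflow], with a gain.  An edge going from
    [A :\: B] to [B :\: A] counts with its lower bound in A and with minus its
    upper bound in B, but in neither the intersection nor the union; so the term
    of e0 can be removed from the left-hand side. *)
Lemma least_outflow_uncross l u A B e0 :
  (forall e, l e <= u e) -> e0 \in leaving A -> e0 \in entering B ->
  least_outflow l u A - l e0 + (least_outflow l u B + u e0) <=
  least_outflow l u (A :&: B) + least_outflow l u (A :|: B).
Proof.
move=> lu; rewrite !inE => /andP[tA hA] /andP[hB tB].
rewrite !(least_outflowD1 _ _ _ e0) /contribution !inE.
rewrite tA hB (negPf hA) (negPf tB) /=.
set a := \sum_(_ | _) _; set a' := \sum_(_ | _) _.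
set c := \sum_(_ | _) _; set c' := \sum_(_ | _) _.
suff: a + a' <= c + c' by lra.
(* Supermodularity holds edge by edge, in each position of the two ends. *)
rewrite -!big_split /=; apply: ler_sum => e _; rewrite !inE.
have := lu e.
case: (tl e \in A); case: (hd e \in A); case: (tl e \in B);
  case: (hd e \in B) => /=; lra.
Qed.

(** Fixing the value t on e0 only affects the constraints of sets that e0
    enters, which bound t from below by [low B], and of sets that it leaves,
    which bound t from above.  The largest lower limit is a valid choice:
    [low B] is below the upper limit of A because, after uncrossing, this follows
    from the constraints of [A :&: B] and [A :|: B] and submodularity of b. *)
Lemma submodular_flow_fix_edge b l u e0 :
  submodular b -> (forall e, l e <= u e) ->
  (forall A, least_outflow l u A <= b A) ->
  exists2 t, l e0 <= t <= u e0 &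
    forall A, least_outflow [eta l with e0 |-> t] [eta u with e0 |-> t] A
              <= b A.
Proof.
move=> sub_b lu feas.
pose low B := least_outflow l u B + u e0 - b B.
pose t := \big[Num.max/l e0]_(B | e0 \in entering B) low B.
have low_t B : e0 \in entering B -> low B <= t.
  by move=> eB; apply: (le_bigmax_cond _ low).
have t_up A : e0 \in leaving A -> t <= b A - (least_outflow l u A - l e0).
  move=> eA; apply: bigmax_le => [|B eB]; first by have := feas A; lra.
  have := @least_outflow_uncross l u A B e0 lu eA eB.
  have := sub_b A B; have := feas (A :&: B); have := feas (A :|: B).
  rewrite /low; lra.
exists t => [|A].
  apply/andP; split; first exact: bigmax_ge_id.
  by apply: bigmax_le => [//|B eB]; have := feas B; rewrite /low; lra.
have := feas A; have := low_t A; have := t_up A; rewrite /low.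
rewrite !(least_outflowD1 _ _ _ e0).
rewrite [X in _ -> _ -> _ -> _ + X <= _](eq_bigr (contribution l u A));
  last first.
  by move=> e /negPf e_e0; rewrite /contribution /= e_e0.
rewrite /contribution /= eqxx !inE.
set s := \sum_(_ | _) _.
case: (tl e0 \in A); case: (hd e0 \in A) => /= up lo feasA.
- lra.
- by have := up isT; lra.
- by have := lo isT; lra.
- lra.
Qed.

(** Edmonds and Giles, for fully submodular b. *)
Theorem submodular_flow b l u :
  submodular b -> (forall e, l e <= u e) ->
  (forall A, least_outflow l u A <= b A) ->
  exists2 f, (forall e, l e <= f e <= u e) & forall A, net_outflow f A <= b A.
Proof.
move=> sub_b lu feas.
(* The edges of a list can be made tight without losing feasibility. *)
suff [l' [u' [l'u' lu' feas' tight]]] : exists l' u',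
    [/\ forall e, l' e <= u' e, forall e, l e <= l' e /\ u' e <= u e,
        forall A, least_outflow l' u' A <= b A &
        forall e, e \in enum E -> l' e = u' e].
  exists l' => [e|A].
    by have [-> /=] := lu' e; apply: le_trans (l'u' e).
  suff <-: least_outflow l' u' A = net_outflow l' A by [].
  congr (_ - _); apply: eq_bigr => e _.
  by rewrite tight ?mem_enum.
elim: (enum E) => [|e0 s [l' [u' [l'u' lu' feas' tight]]]].
  by exists l, u; split.
have [t /andP[l't tu'] feas_t] :=
  @submodular_flow_fix_edge b l' u' e0 sub_b l'u' feas'.
exists [eta l' with e0 |-> t], [eta u' with e0 |-> t].
split=> // e; rewrite /= ?inE; case: eqP => [e_e0|_] //=.
  rewrite e_e0; have [l_l' u'_u] := lu' e0.
  by split; [apply: le_trans l't | apply: le_trans tu' _].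
exact: tight.
Qed.

End SubmodularFlow.

(** * Flows with bounded excess *)

Lemma in_imset_Some (V : finType) (x : option V) (A : {set V}) :
  (x \in Some @: A) = (if x is Some y then y \in A else false).
Proof.
case: x => [y|]; last by apply/imsetP => -[].
by apply: mem_imset => ? ? [].
Qed.

(** Hoffman's theorem: the upper bounds M constrain the outflow of every set,
    the lower bounds m its inflow.  Both kinds of constraint become upper bounds
    on outflow once an isolated vertex [None] is added: a set B without [None]
    is bounded by M on B, and a set with [None], whose outflow is the inflow of
    its complement, by -m on the complement of B.  Submodularity of this bound
    amounts to m <= M. *)
Theorem bounded_excess_flow (R : realDomainType) (V E : finType)
    (tl hd : E -> V) (l u : E -> R) (m M : V -> R) :
  (forall e, l e <= u e) -> (forall x, m x <= M x) ->
  (forall A, least_outflow tl hd l u A <= \sum_(x in A) M x) ->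
  (forall A, least_outflow tl hd l u (~: A) <= - \sum_(x in A) m x) ->
  exists2 f, (forall e, l e <= f e <= u e) &
    forall x, m x <= \sum_(e | tl e == x) f e - \sum_(e | hd e == x) f e
                  <= M x.
Proof.
move=> lu mM feasM feasm.
pose excess_bound x (B : {set option V}) : R :=
  if None \in B then (if Some x \in B then 0 else - m x)
  else (if Some x \in B then M x else 0).
pose b B := \sum_x excess_bound x B.
have sub_b : submodular b.
  move=> A B; rewrite /b -!big_split /=; apply: ler_sum => x _.
  rewrite /excess_bound !inE; have := mM x.
  case: (None \in A); case: (None \in B); case: (Some x \in A);
    case: (Some x \in B) => /=; lra.
have liftE l' u' B : least_outflow (Some \o tl) (Some \o hd) l' u' B =
    least_outflow tl hd l' u' (Some @^-1: B) :> R.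
  by congr (_ - _); apply: eq_bigl => e; rewrite !inE.
have bM (A : {set V}) : b (Some @: A) = \sum_(x in A) M x.
  rewrite [RHS]big_mkcond; apply: eq_bigr => x _.
  by rewrite /excess_bound !in_imset_Some.
have bm (A : {set V}) : b (~: (Some @: A)) = - \sum_(x in A) m x.
  rewrite -sumrN [RHS]big_mkcond; apply: eq_bigr => x _.
  by rewrite /excess_bound !in_setC !in_imset_Some /=; case: (x \in A).
have SomeK (A : {set V}) : Some @^-1: (Some @: A) = A.
  by apply/setP => x; rewrite inE in_imset_Some.
(* These two kinds of sets exhaust the subsets of [option V]. *)
have cover (B : {set option V}) :
    B = Some @: (Some @^-1: B) \/ B = ~: (Some @: (~: (Some @^-1: B))).
  case: (boolP (None \in B)) => nB; [right | left]; apply/setP => -[x|];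
    by rewrite ?in_setC in_imset_Some ?in_setC ?inE ?negbK // (negPf nB).
have [|f f_lu f_b] :=
  @submodular_flow R _ E (Some \o tl) (Some \o hd) b l u sub_b lu.
  move=> B; rewrite liftE; case: (cover B) => ->.
    by rewrite bM SomeK.
  by rewrite bm preimsetC SomeK.
exists f => // x.
have := f_b (Some @: [set x]); have := f_b (~: (Some @: [set x])).
rewrite /net_outflow !liftE bM bm preimsetC SomeK !big_set1.
have outflowC : least_outflow tl hd f f (~: [set x]) =
    - least_outflow tl hd f f [set x].
  rewrite /least_outflow opprB; congr (_ - _); apply: eq_bigl => e;
    by rewrite !inE negbK andbC.
rewrite outflowC -/(net_outflow tl hd f [set x]) net_outflowE big_set1; lra.
Qed.

(** * Cuts and degrees in oriented graphs *)

Section OrientedGraphs.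

Context {V E : finType}.
Implicit Types (G : multigraph V E) (D : digraph V E) (A : {set V}).

Local Notation outs D A := (leaving (tail D) (head D) A).
Local Notation ins D A := (entering (tail D) (head D) A).

Lemma net_outflow_excess (R : realDomainType) D (f : E -> R) A :
  net_outflow (tail D) (head D) f A =
  \sum_(x in A) (\sum_(e in out_edges D x) f e - \sum_(e in in_edges D x) f e).
Proof.
rewrite net_outflowE; apply: eq_bigr => x _.
by congr (_ - _); apply: eq_bigl => e; rewrite inE.
Qed.

Lemma least_outflow_const (R : realDomainType) D (a b : R) A :
  least_outflow (tail D) (head D) (fun=> a) (fun=> b) A =
  #|outs D A|%:R * a - #|ins D A|%:R * b.
Proof. by rewrite /least_outflow !sumr_const !mulr_natl. Qed.

Lemma leavingC D A : outs D (~: A) = ins D A.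
Proof. by apply/setP => e; rewrite !inE negbK andbC. Qed.

Lemma enteringC D A : ins D (~: A) = outs D A.
Proof. by apply/setP => e; rewrite !inE negbK andbC. Qed.

Lemma cut_sizeE G D A :
  orientation G D -> cut_size G A = (#|outs D A| + #|ins D A|)%N.
Proof.
move=> GD; have disj : outs D A :&: ins D A = set0.
  apply/setP => e; rewrite !inE.
  by case: (tail D e \in A); case: (head D e \in A).
rewrite -cardsUI disj cards0 addn0; apply: eq_card => e.
rewrite !inE; apply/exists_inP/orP => [[x xA /exists_inP[y]] | ].
  rewrite inE GD => yA /eqP ends_xy.
  have /set2P[] : x \in [set tail D e; head D e] by rewrite ends_xy set21.
    have /set2P[] : y \in [set tail D e; head D e] by rewrite ends_xy set22.
      by move=> yt xt; rewrite yt -xt xA in yA.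
    by move=> <- <-; left; rewrite xA.
  have /set2P[] : y \in [set tail D e; head D e] by rewrite ends_xy set22.
    by move=> <- <-; right; rewrite xA.
  by move=> yh xh; rewrite yh -xh xA in yA.
case=> /andP[xA yA].
  exists (tail D e) => //; apply/exists_inP; exists (head D e).
    by rewrite inE.
  by rewrite GD.
exists (head D e) => //; apply/exists_inP; exists (tail D e).
  by rewrite inE.
by rewrite GD setUC.
Qed.

Lemma degreeE G D x :
  orientation G D -> degree G x = (#|out_edges D x| + #|in_edges D x|)%N.
Proof.
move=> GD; have disj : out_edges D x :&: in_edges D x = set0.
  apply/setP => e; rewrite !inE; apply/andP => -[/eqP tx /eqP hx].
  by have := tail_neq_head D e; rewrite tx hx eqxx.
rewrite -cardsUI disj cards0 addn0; apply: eq_card => e.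
by rewrite !inE GD !inE ![x == _]eq_sym.
Qed.

Lemma exists_orientation G : exists D, orientation G D.
Proof.
have /fin_all_exists[p endsE] e : exists p : V * V,
    p.1 != p.2 /\ ends G e = [set p.1; p.2].
  have /eqP/cards2P[x [y [xy ->]]] := ends_card2 G e.
  by exists (x, y).
exists (Digraph (fun e => (endsE e).1)) => e.
by have [_ ->] := endsE e.
Qed.

Lemma card_setI_sum (B A : {set V}) :
  (#|B :&: A|)%:Z = \sum_(x in A) (x \in B)%:R.
Proof.
rewrite -natr_sum -sum1_card big_mkcond [in RHS]big_mkcond natz; congr Posz.
by apply: eq_bigr => x _; rewrite inE; case: (x \in A); case: (x \in B).
Qed.

Lemma notin_bisected (V1 V2 : {set V}) x :
  V1 :|: V2 = [set: V] -> [disjoint V1 & V2] -> (x \in V1) = (x \notin V2).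
Proof.
move=> cover disj; have := in_setT x; rewrite -cover inE.
case: (boolP (x \in V1)) => [xV1 _|_ /= -> //].
by rewrite (disjointFr disj xV1).
Qed.

(** In a cubic graph, outdegree minus indegree is 1 on V_2 and -1 on V_1. *)
Lemma net_outdegree G D (V1 V2 : {set V}) A :
  cubic G -> orientation G D -> V1 :|: V2 = [set: V] ->
  V1 = [set x | #|out_edges D x| == 1%N] ->
  V2 = [set x | #|out_edges D x| == 2%N] ->
  #|outs D A|%:Z - #|ins D A|%:Z = #|V2 :&: A|%:Z - #|V1 :&: A|%:Z.
Proof.
move=> cubicG GD cover V1E V2E.
have := net_outflow_excess D (fun=> 1 : int) A.
rewrite /net_outflow least_outflow_const !mulr1 !natz => ->.
rewrite !card_setI_sum -sumrB; apply: eq_bigr => x _.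
rewrite !sumr_const; have := in_setT x; rewrite -cover V1E V2E !inE.
have := cubicG x; rewrite (degreeE x GD).
by case: eqP => [->|_]; [|case: eqP => [->|//]] => /= deg _; lia.
Qed.

Lemma imbalance_outs_ins G D (V1 V2 : {set V}) A :
  cubic G -> orientation G D -> V1 :|: V2 = [set: V] ->
  V1 = [set x | #|out_edges D x| == 1%N] ->
  V2 = [set x | #|out_edges D x| == 2%N] ->
  imbalance V1 V2 A = `|#|outs D A|%:Z - #|ins D A|%:Z|%N.
Proof.
move=> cubicG GD cover V1E V2E.
by rewrite (net_outdegree A cubicG GD cover V1E V2E).
Qed.

(** * Orientable bisections *)

Lemma cut_condition_of_orientable G (V1 V2 : {set V}) :
  cubic G -> V1 :|: V2 = [set: V] -> orientable G V1 V2 ->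
  cut_condition G V1 V2.
Proof.
move=> cubicG cover [D GD [V1E V2E]] A.
rewrite (imbalance_outs_ins A cubicG GD cover V1E V2E) (cut_sizeE A GD).
lia.
Qed.

(** Let c be the prescribed outdegree.  Reversing the edges with f = 1 in a
    reference orientation D lowers the outdegree of x by the excess of f at x,
    so f must have excess m x = outdeg x - c x.  Over A, twice the sum of m is
    out(A) - in(A) minus the signed imbalance of A, and Hoffman's two conditions
    for f in [0, 1] say that this imbalance is at most d(A) in absolute
    value. *)
Lemma orientable_of_cut_condition G (V1 V2 : {set V}) :
  cubic G -> V1 :|: V2 = [set: V] -> [disjoint V1 & V2] ->
  cut_condition G V1 V2 -> orientable G V1 V2.
Proof.
move=> cubicG cover disj cut.
have [D GD] := exists_orientation G.
pose c x : int := 1 + (x \in V2)%:R.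
pose m x : int := #|out_edges D x|%:Z - c x.
have sum_m A : (\sum_(x in A) m x) *+ 2 =
    #|outs D A|%:Z - #|ins D A|%:Z - (#|V2 :&: A|%:Z - #|V1 :&: A|%:Z).
  have := net_outflow_excess D (fun=> 1 : int) A.
  rewrite /net_outflow least_outflow_const !mulr1 !natz => ->.
  rewrite !card_setI_sum -!sumrB -sumrMnl; apply: eq_bigr => x _.
  rewrite !sumr_const (notin_bisected x cover disj) /m /c.
  have := cubicG x; rewrite (degreeE x GD).
  by case: (x \in V2) => /=; lia.
have cutA A : (imbalance V1 V2 A <= #|outs D A| + #|ins D A|)%N.
  by rewrite -(cut_sizeE A GD).
have [||||f f01 fm] := @bounded_excess_flow int V E (tail D) (head D)
  (fun=> 0) (fun=> 1) m m.
- by [].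
- by [].
- move=> A; rewrite least_outflow_const mulr0 mulr1 natz.
  have := sum_m A; have := cutA A; rewrite /imbalance mulr2n.
  by set S := \sum_(_ in _) _; lia.
- move=> A; rewrite least_outflow_const leavingC enteringC mulr0 mulr1 natz.
  have := sum_m A; have := cutA A; rewrite /imbalance mulr2n.
  by set S := \sum_(_ in _) _; lia.
have tail_neq e : (if f e == 1 then head D e else tail D e) !=
                  (if f e == 1 then tail D e else head D e).
  by case: (f e == 1); rewrite ?[head D e == _]eq_sym tail_neq_head.
pose D' := Digraph tail_neq.
have GD' : orientation G D'.
  by move=> e; rewrite GD /=; case: (f e == 1); rewrite // setUC.
have outD' x : #|out_edges D' x|%:Z = c x.
  have fmx : \sum_(e | tail D e == x) f e - \sum_(e | head D e == x) f e = m x.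
    by apply/eqP; rewrite eq_le andbC; apply: fm.
  have sumE (g : E -> V) (h : E -> int) :
      \sum_(e | g e == x) h e = \sum_e (if g e == x then h e else 0).
    exact: big_mkcond.
  have cardE (g : E -> V) :
      #|[set e | g e == x]|%:Z = \sum_(e | g e == x) 1.
    by rewrite -natz -sum1_card natr_sum; apply: eq_bigl => e; rewrite inE.
  rewrite -[c x](subKr #|out_edges D x|%:Z) -/(m x) -fmx.
  rewrite !cardE !sumE -!sumrB; apply: eq_bigr => e _ /=.
  have [] : f e = 0 \/ f e = 1 by have := f01 e; lia.
    by move=> ->; case: eqP; case: eqP => // *; lia.
  by move=> ->; case: eqP; case: eqP => // *; lia.
exists D' => //; split; apply/setP => x; rewrite ?(notin_bisected x cover disj);
  by rewrite inE; have := outD' x; rewrite /c; case: (x \in V2) => /=; lia.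
Qed.

(** * Flows and bisections *)

(** With a = out(A), b = in(A), n = |A|: as r >= 2, the stronger of the two
    right-hand inequalities is the one where the larger of a and b comes with
    coefficient 1, and max(a, b) - (r - 1) min(a, b) is half the numerator on
    the left, because max and min are (d + Delta) / 2 and (d - Delta) / 2. *)
Lemma flow_cut_bound (R : realFieldType) (r alpha : R) (a b n : nat) :
  2 <= r -> (0 < n)%N ->
  ((2 * (a + b)%:R - ((a + b)%:R - (`|a%:Z - b%:Z|%N)%:R) * r) / (2 * n%:R)
     <= alpha) =
  (a%:R - b%:R * (r - 1) <= alpha * n%:R) &&
  (b%:R - a%:R * (r - 1) <= alpha * n%:R).
Proof.
move=> r2 n0; rewrite ler_pdivrMr; last by rewrite mulr_gt0 ?ltr0n.
wlog ab : a b / (a <= b)%N => [hw|].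
  case: (leqP a b) => [/hw //|/ltnW/hw].
  by rewrite addnC distnC andbC.
have -> : `|a%:Z - b%:Z|%N = (b - a)%N by lia.
have abR : a%:R <= b%:R :> R by rewrite ler_nat.
rewrite natrB // natrD.
apply/idP/andP => [h|[_ h]]; [split|]; nra.
Qed.

Lemma sum_card_bounds (R : realDomainType) (S : {set E}) (a b : R)
    (f : E -> R) :
  (forall e, a <= f e <= b) ->
  #|S|%:R * a <= \sum_(e in S) f e <= #|S|%:R * b.
Proof.
move=> fab; rewrite !mulr_natl -!sumr_const.
by apply/andP; split; apply: ler_sum => e _; have /andP[] := fab e.
Qed.

(** Three edges in the same direction would give an excess of at least 3. *)
Lemma flow_outdegree (R : realType) (r alpha : R) G D (f : E -> R) x :
  cubic G -> alpha < 3 -> orientation G D -> is_flow r alpha D f ->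
  (#|out_edges D x| == 1%N) || (#|out_edges D x| == 2%N).
Proof.
move=> cubicG alpha3 GD [f1r exc].
have := cubicG x; rewrite (degreeE x GD) => deg.
have /andP[out_ge _] := sum_card_bounds (out_edges D x) f1r.
have /andP[in_ge _] := sum_card_bounds (in_edges D x) f1r.
have := exc x; rewrite ler_norml => /andP[exc_ge exc_le].
have out3 : #|out_edges D x| <> 3%N.
  move=> out; have /eqP : #|in_edges D x| = 0%N by lia.
  rewrite cards_eq0 => /eqP in0.
  by move: exc_le out_ge; rewrite in0 big_set0 out; lra.
have out0 : #|out_edges D x| <> 0%N.
  move=> out; have in3 : #|in_edges D x| = 3%N by lia.
  move/eqP: out; rewrite cards_eq0 => /eqP out0.
  by move: exc_ge in_ge; rewrite out0 big_set0 in3; lra.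
lia.
Qed.

Lemma bisection_of_flow (R : realType) (r alpha : R) G :
  cubic G -> 2 <= r -> alpha < 3 -> admits_flow r alpha G ->
  exists V1 V2 : {set V},
    [/\ bisection V1 V2, cut_condition G V1 V2 &
        flow_condition r alpha G V1 V2].
Proof.
move=> cubicG r2 alpha3 [D GD [f f_flow]].
pose Vi i := [set x | #|out_edges D x| == i].
have cover : Vi 1%N :|: Vi 2%N = [set: V].
  apply/setP => x; rewrite !inE.
  exact: flow_outdegree cubicG alpha3 GD f_flow.
have orientableG : orientable G (Vi 1%N) (Vi 2%N) by exists D.
exists (Vi 1%N), (Vi 2%N); split.
- split=> //.
    rewrite -setI_eq0; apply/eqP/setP => x; rewrite !inE.
    by case: eqP => // ->.
  (* No edge leaves or enters V, so its signed imbalance vanishes. *)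
  have := net_outdegree [set: V] cubicG GD cover erefl erefl.
  have -> : outs D [set: V] = set0 by apply/setP => e; rewrite !inE.
  have -> : ins D [set: V] = set0 by apply/setP => e; rewrite !inE.
  by rewrite cards0 !setIT; lia.
- exact: cut_condition_of_orientable.
move=> A A0 /=; have [f1r exc] := f_flow.
rewrite (imbalance_outs_ins A cubicG GD cover erefl erefl) (cut_sizeE A GD).
rewrite flow_cut_bound ?card_gt0 //.
have [hi lo] : net_outflow (tail D) (head D) f A <= alpha * #|A|%:R /\
    - (alpha * #|A|%:R) <= net_outflow (tail D) (head D) f A.
  rewrite !net_outflow_excess mulr_natr -sumr_const -sumrN.
  by split; apply: ler_sum => x _; have := exc x; rewrite ler_norml => /andP[].
have /andP[out_ge out_le] := sum_card_bounds (outs D A) f1r.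
have /andP[in_ge in_le] := sum_card_bounds (ins D A) f1r.
by rewrite /net_outflow /least_outflow in hi lo; apply/andP; split; lra.
Qed.

Lemma flow_of_bisection (R : realType) (r alpha : R) G (V1 V2 : {set V}) :
  cubic G -> 2 <= r -> 0 <= alpha ->
  bisection V1 V2 -> cut_condition G V1 V2 -> flow_condition r alpha G V1 V2 ->
  admits_flow r alpha G.
Proof.
move=> cubicG r2 alpha0 [cover disj _] cut flow.
have [D GD [V1E V2E]] := orientable_of_cut_condition cubicG cover disj cut.
have bounds A :
    (#|outs D A|%:R - #|ins D A|%:R * (r - 1) <= alpha * #|A|%:R) &&
    (#|ins D A|%:R - #|outs D A|%:R * (r - 1) <= alpha * #|A|%:R).
  have [->|A0] := eqVneq A set0.
    have -> : outs D set0 = set0 by apply/setP => e; rewrite !inE.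
    have -> : ins D set0 = set0 by apply/setP => e; rewrite !inE.
    by rewrite !cards0 !mul0r mulr0 subr0 lexx.
  rewrite -flow_cut_bound ?card_gt0 //.
  rewrite -(imbalance_outs_ins A cubicG GD cover V1E V2E) -(cut_sizeE A GD).
  exact: flow.
have [||||f f1r exc] := @bounded_excess_flow R V E (tail D) (head D)
  (fun=> 1) (fun=> r - 1) (fun=> - alpha) (fun=> alpha).
- by move=> _; lra.
- by move=> _; lra.
- move=> A; rewrite least_outflow_const mulr1 sumr_const -[alpha *+ _]mulr_natr.
  by have /andP[] := bounds A.
- move=> A; rewrite least_outflow_const leavingC enteringC mulr1.
  rewrite sumr_const mulNrn opprK -[alpha *+ _]mulr_natr.
  by have /andP[] := bounds A.
exists D => //; exists f; split=> // x.
rewrite ler_norml; have := exc x.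
by rewrite !(eq_bigl _ _ (in_set _)).
Qed.

End OrientedGraphs.

(** * The characterization *)

Theorem theorem5 (R : realType) (V E : finType) (G : multigraph V E)
    (r alpha : R) (cubicG : cubic G)
    (r_ge2 : 2 <= r) (alpha_ge0 : 0 <= alpha) (alpha_lt3 : alpha < 3) :
  (admits_flow r alpha G <->
   exists V1 V2 : {set V},
     [/\ bisection V1 V2,
         cut_condition G V1 V2 &
         flow_condition r alpha G V1 V2]) /\
  (forall V1 V2 : {set V},
     bisection V1 V2 -> orientable G V1 V2 -> cut_condition G V1 V2).
Proof.
split; last by move=> V1 V2 [cover _ _]; apply: cut_condition_of_orientable.
split=> [|[V1 [V2 [bis cut flow]]]]; first exact: bisection_of_flow.
exact: flow_of_bisection bis cut flow.
Qed.
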